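(* Suppose $u(q)$ is a measurable function of $q$. Let $1\le k\le N$, let $1\le i_1<i_2<\cdots<i_k\le N$ be integers, and let $0=t_0\le t_1\le t_2\le\cdots\le t_k\le 1$. Define $$\tilde F(t_1,\dots,t_k):=P\{F_u(\hat u_{i_1})<t_1,\;F_u(\hat u_{i_2})<t_2,\;\dots,\;F_u(\hat u_{i_k})<t_k\}$$ and $$\tau_s:=\sup_{\{x\in\mathbb{R}:\,F_u(x)<t_s\}}F_u(x),\qquad s=1,\dots,k.$$ Then $$\tilde F(t_1,\dots,t_k)=\int_{\mathbf{D}_{\tau_1,\dots,\tau_k}}f_{i_1,\dots,i_k}(x_1,\dots,x_k)\,dx_1\cdots dx_k.$$ Furthermore, $$\tilde F(t_1,\dots,t_k)\le\int_{\mathbf{D}_{t_1,\dots,t_k}}f_{i_1,\dots,i_k}(x_1,\dots,x_k)\,dx_1\cdots dx_k,$$ and equality holds if $F_u$ is continuous.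
   Context: Let $q$ be a random vector taking values in a compact set $\mathcal{Q}$, with a multivariate probability density function, and let $u$ be a real-valued measurable function of $q$. Write $F_u(\gamma):=P\{u(q)\le\gamma\}$, $\gamma\in\mathbb{R}$, for the cumulative distribution function of $u(q)$. Let $q^1,\dots,q^N$ be i.i.d. samples with the same distribution as $q$, and let $\hat u_i$ ($1\le i\le N$) be the $i$-th smallest of $u(q^1),\dots,u(q^N)$, so $\hat u_1\le\hat u_2\le\cdots\le\hat u_N$ (order statistics). For integers $1\le i_1<\cdots<i_k\le N$ define $$f_{i_1,\dots,i_k}(x_1,\dots,x_k):=N!\prod_{s=0}^{k}\frac{(x_{s+1}-x_s)^{i_{s+1}-i_s-1}}{(i_{s+1}-i_s-1)!},$$ with $x_0:=0$, $x_{k+1}:=1$, $i_0:=0$, $i_{k+1}:=N+1$ (and $0^0=1$). For real numbers $a_1,\dots,a_k\in[0,1]$ define $$\mathbf{D}_{a_1,\dots,a_k}:=\{(x_1,\dots,x_k):\;0\le x_1\le x_2\le\cdots\le x_k,\;x_s\le a_s,\;s=1,\dots,k\}.$$ The supremum of the empty set (which can occur only when $t_s=0$) is taken to be $0$. *)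

(* Defs.v *)
From HB Require Import structures.
From mathcomp Require Import all_boot all_order all_algebra.
From mathcomp Require Import all_classical all_reals all_analysis.

Set Implicit Arguments.
Unset Strict Implicit.
Unset Printing Implicit Defensive.

Import Order.TTheory GRing.Theory Num.Theory.
Import numFieldNormedType.Exports.

Local Open Scope classical_set_scope.
Local Open Scope ring_scope.

Section lebesgue_tuple.
Context (R : realType).
Local Open Scope ereal_scope.

Definition tuple_cons (n : nat) (p : R * n.-tuple R) : n.+1.-tuple R :=
  [tuple of p.1 :: p.2].

(* R^n is rendered as n.-tuple R, whose sigma-algebra is generated by the
   coordinates; the library has no n-dimensional Lebesgue measure. *)
Fixpoint lebesgue_tuple (n : nat) : set (n.-tuple R) -> \bar R :=
  match n with
  | 0 => \d_[tuple]
  | m.+1 => pushforward (lebesgue_measure \x @lebesgue_tuple m)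
              (@tuple_cons m)
  end.

Lemma measurable_tuple_cons n : measurable_fun setT (@tuple_cons n).
Proof. exact: measurable_cons. Qed.

Definition tuple_uncons n (t : n.+1.-tuple R) : R * n.-tuple R :=
  (thead t, [tuple of behead t]).

Lemma tuple_consK n : cancel (@tuple_cons n) (@tuple_uncons n).
Proof. by move=> [x t]; congr pair; apply/val_inj. Qed.

Lemma measurable_tuple_uncons n : measurable_fun setT (@tuple_uncons n).
Proof.
apply/measurable_fun_pair; first exact: measurable_tnth.
exact: measurable_behead.
Qed.

Lemma lebesgue_tuple_spec n :
  exists2 m : {sigma_finite_measure set (n.-tuple R) -> \bar R},
    @lebesgue_tuple n = m &
    forall A : 'I_n -> set R, (forall i, measurable (A i)) ->
      m [set x | forall i, A i (tnth x i)] =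
      \prod_(i < n) lebesgue_measure (A i).
Proof.
elim: n => [|n [m lm mE]].
  exists \d_([tuple] : 0.-tuple R) => // A mA.
  by rewrite big_ord0 /= diracE mem_set// => -[].
pose muM := measure_function_pushforward__canonical__measure_function_Measure
  (lebesgue_measure \x m) (@measurable_tuple_cons n).
have mu_sf : sigma_finite setT muM.
  have /sigma_finiteP[F [FT ndF Foo]] := sigma_finiteT (@lebesgue_measure R).
  have /sigma_finiteP[G [GT ndG Goo]] := sigma_finiteT m.
  have FG i : measurable (F i `*` G i).
    by apply: measurableX; [have [] := Foo i|have [] := Goo i].
  exists (fun i => @tuple_uncons n @^-1` (F i `*` G i)) => [|i].
    apply/seteqP; split => // x _.
    have : [set: _] (thead x) by []; rewrite FT => -[i _ Fx].
    have : [set: _] [tuple of behead x] by []; rewrite GT => -[j _ Gx].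
    exists (maxn i j) => //; split => /=.
      by move: (thead x) Fx; exact/subsetPset/ndF/leq_maxl.
    by move: [tuple of behead x] Gx; exact/subsetPset/ndG/leq_maxr.
  split.
    rewrite -[X in measurable X]setTI.
    exact: (measurable_tuple_uncons measurableT (FG i)).
  rewrite /= /pushforward -comp_preimage (_ : _ \o _ = id); last first.
    by apply/funext => x; exact: tuple_consK.
  have [? ?] := Foo i; have [? ?] := Goo i.
  by rewrite preimage_id product_measure1E// lte_mul_pinfty// ge0_fin_numE.
pose muS : {sigma_finite_measure set (n.+1.-tuple R) -> \bar R} :=
  HB.pack (Measure.sort muM) (Measure.class muM)
    (Measure_isSigmaFinite.Build _ _ _ (Measure.sort muM) mu_sf).
exists muS => [|A mA]; first by rewrite /= lm.
rewrite big_ord_recl -mE// -product_measure1E; last 2 first.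
- exact: mA.
- rewrite (_ : [set _ | _] = \bigcap_(i in [set: 'I_n])
    ((@tnth n R)^~ i @^-1` A (lift ord0 i))); last first.
    by apply/seteqP; split => x Ax i => [_|]; [exact: Ax|exact: (Ax i I)].
  apply: fin_bigcap_measurable => [|i _]; first exact: finite_finset.
  by rewrite -[X in measurable X]setTI; exact: measurable_tnth.
congr ((_ \x _) _).
apply/seteqP; split => -[x t] /=.
  move=> At; split; first exact: (At ord0).
  by move=> i; have := At (lift ord0 i); rewrite tnthS.
move=> [Ax At] i; case: (unliftP ord0 i) => [j ->|->//].
by rewrite tnthS.
Qed.

Let lebesgue_tuple0 n : @lebesgue_tuple n set0 = 0.
Proof. by have [m -> _] := lebesgue_tuple_spec n; exact: measure0. Qed.

Let lebesgue_tuple_ge0 n A : 0 <= @lebesgue_tuple n A.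
Proof. by have [m -> _] := lebesgue_tuple_spec n; exact: measure_ge0. Qed.

Let lebesgue_tuple_sigma_additive n : semi_sigma_additive (@lebesgue_tuple n).
Proof.
by have [m -> _] := lebesgue_tuple_spec n; exact: measure_semi_sigma_additive.
Qed.

HB.instance Definition _ n := isMeasure.Build _ _ _ (@lebesgue_tuple n)
  (@lebesgue_tuple0 n) (@lebesgue_tuple_ge0 n)
  (@lebesgue_tuple_sigma_additive n).

Let lebesgue_tuple_sigma_finite n : sigma_finite setT (@lebesgue_tuple n).
Proof. by have [m -> _] := lebesgue_tuple_spec n; exact: sigma_finiteT. Qed.

HB.instance Definition _ n := Measure_isSigmaFinite.Build _ _ _
  (@lebesgue_tuple n) (@lebesgue_tuple_sigma_finite n).

Lemma lebesgue_tuple_box n (A : 'I_n -> set R) :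
  (forall i, measurable (A i)) ->
  lebesgue_tuple [set x : n.-tuple R | forall i, A i (tnth x i)] =
  \prod_(i < n) lebesgue_measure (A i).
Proof. by have [m -> mE] := lebesgue_tuple_spec n; exact: mE. Qed.

End lebesgue_tuple.

(* The topology on R^n is the library's one on 'rV[R]_n. *)
Definition rv_of_tuple (R : realType) (n : nat) (x : n.-tuple R) : 'rV[R]_n :=
  \row_i tnth x i.

Definition compact_tuple (R : realType) (n : nat) (Q : set (n.-tuple R)) :=
  compact [set rv_of_tuple x | x in Q].

Section random_vectors.
Context d (Omega : measurableType d) (R : realType) (P : probability Omega R).

Definition is_density (n : nat) (X : {RV P >-> n.-tuple R})
    (p : n.-tuple R -> R) :=
  [/\ measurable_fun [set: n.-tuple R] p,
      forall x, 0 <= p x &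
      forall A, measurable A ->
        distribution P X A = (\int[@lebesgue_tuple R n]_(x in A) (p x)%:E)%E].

Definition mutually_independent (d' : measure_display)
    (T : measurableType d') (N : nat) (X : 'I_N -> {RV P >-> T}) :=
  forall (J : {set 'I_N}) (A : 'I_N -> set T),
    (forall j, measurable (A j)) ->
    P [set w | forall j, j \in J -> A j (X j w)] =
    (\prod_(j in J) P [set w | A j (X j w)])%E.

Definition identically_distributed (d' : measure_display)
    (T : measurableType d') (X Y : {RV P >-> T}) :=
  forall A, measurable A -> distribution P X A = distribution P Y A.

(* P{u(X) <= gamma}; the library's cdf would require u \o X to be bundled as a
   random variable, while u may be measurable only on a set containing the
   range of X. *)
Definition cdf_of (T : Type) (X : Omega -> T) (u : T -> R) (gamma : R) : R :=
  fine (P [set w | u (X w) <= gamma]).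

End random_vectors.

(* i-th smallest of v_1, ..., v_N, with i counted from 1 *)
Definition order_stat (R : realType) (N : nat) (v : 'I_N -> R) (i : nat) : R :=
  nth 0 (sort <=%R [seq v j | j <- enum 'I_N]) i.-1.

(* For s = (s_1, ..., s_k), the sequence a, s_1, ..., s_k, b, b, ...
   indexed from 0: adds the conventional endpoints s_0 = a, s_{k+1} = b. *)
Definition with_ends (T : Type) (a b : T) (s : seq T) (j : nat) : T :=
  nth b (a :: s) j.

(* The subtractions i_(s+1) - i_s - 1 are on nat; they are exact for
   0 < i_1 < ... < i_k < N + 1. *)
Definition order_density (R : realType) (N k : nat) (i : k.-tuple nat)
    (x : k.-tuple R) : R :=
  let i_ := with_ends 0%N N.+1 i in
  let x_ := with_ends 0 1 x in
  N`!%:R * \prod_(s < k.+1)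
    ((x_ s.+1 - x_ s) ^+ (i_ s.+1 - i_ s - 1)%N
       / ((i_ s.+1 - i_ s - 1)`!)%:R).

Definition ordered_domain (R : realType) (k : nat) (a : k.-tuple R) :
    set (k.-tuple R) :=
  [set x : k.-tuple R | path <=%R 0 x /\ forall s : 'I_k, tnth x s <= tnth a s].

(* The library's sup of the empty set is 0. *)
Definition tau (R : realType) (F : R -> R) (t : R) : R :=
  sup [set F x | x in [set x | F x < t]].

(* Main.v *)
Require Import Defs.
From HB Require Import structures.
From mathcomp Require Import all_boot all_order all_algebra.
From mathcomp Require Import all_classical all_reals all_analysis.
From mathcomp Require Import measurable_realfun lra zify.
Import Order.TTheory GRing.Theory Num.Theory.
Import numFieldNormedType.Exports.
Local Open Scope classical_set_scope.
Local Open Scope ring_scope.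

Set Implicit Arguments.
Unset Strict Implicit.
Unset Printing Implicit Defensive.

(* Since F_u is nondecreasing, {F_u < t_s} is a down-set of the line, and it has
   probability tau_s by continuity from below. Hence F_u (u_(i_s)) < t_s says
   that at least i_s of the samples fall into it, and by independence F~ is a
   multinomial sum M(N, i) in tau_1 <= ... <= tau_k. Let M(y; m, i) be the same
   sum for m points of which the first cell has mass a_1 - y instead of a_1.
   Conditioning on one point gives d/dy M(y; m, i) = - m M(y; m - 1, i - 1), and
   M vanishes at y = a_1 as soon as i_1 > 0; so Taylor's formula at y = a_1 with
   integral remainder expresses M(y; m, i) as the integral over x_1 in [y, a_1]
   of (x_1 - y)^(i_1 - 1) times the same quantity for x_2, ..., x_k started at
   x_1. Iterating this (Tonelli) yields the integral of the order-statistics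
   density. The other two claims follow from tau_s <= t_s, with equality when
   F_u is continuous (intermediate value theorem). *)

(** * Counting polynomials: recursion and derivative *)

(** The demands left once a point is known to lie in cell [c]: it counts towards [i_s] exactly for
    [s >= c] (from 0). Truncation at 0 keeps a met demand met. *)
Definition decr_from (c : nat) (i : seq nat) : seq nat :=
  take c i ++ map predn (drop c i).

Lemma decr_from0 i : decr_from 0 i = map predn i.
Proof. by rewrite /decr_from take0 drop0. Qed.

Lemma decr_from_predn c i :
  decr_from c (map predn i) = map predn (decr_from c i).
Proof. by rewrite /decr_from map_cat !map_take !map_drop. Qed.

Lemma size_decr_from c i : size (decr_from c i) = size i.
Proof. by rewrite size_cat size_map -size_cat cat_take_drop. Qed.

Lemma nth_decr_from c i s :
  nth 0%N (decr_from c i) s = (nth 0 i s - (c <= s))%N.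
Proof.
elim: i c s => [|j i IH] [|c] [|s] //=; rewrite ?nth_nil ?subn0 ?subn1//.
  by move: (IH 0%N s); rewrite decr_from0 subn1.
exact: IH.
Qed.

Section count_poly.
Context {R : comNzRingType}.
Implicit Types (a : seq R) (i : seq nat).

(** Only cell 0 depends on the indeterminate, its left end; the default 1 closes the last cell. *)
Definition cell_width a (c : nat) : {poly R} :=
  (nth 1 a c)%:P - nth 0 ('X :: map polyC a) c.

(* At y < 1, the probability that among m independent uniform points of [y, 1]
   at least i_s are below a_s for every s, times (1 - y)^m; the recursion
   conditions on the cell of one of the points. *)
Fixpoint count_poly a (m : nat) i : {poly R} :=
  if m is m'.+1 then
    \sum_(c < (size a).+1) cell_width a c * count_poly a m' (decr_from c i)
  else (all (eq_op 0%N) i)%:R.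

Lemma count_poly_nil m : count_poly [::] m [::] = (1 - 'X) ^+ m.
Proof.
elim: m => //= m IH; rewrite big_ord_recl big_ord0 /= addr0 exprS.
by rewrite IH /cell_width polyC1.
Qed.

Lemma deriv_cell_width a c : (cell_width a c)^`() = - (c == 0%N)%:R.
Proof.
rewrite /cell_width derivB derivC sub0r; case: c => [|c] /=.
  by rewrite derivX.
have [cs|cs] := ltnP c (size a).
  by rewrite (nth_map 0)// derivC.
by rewrite nth_default ?size_map// deriv0.
Qed.

(** By the product rule, since cell 0 alone has a nonconstant width, of derivative -1: one of the
    [m] points is put into cell 0, which lowers every demand, and the [m] terms agree because
    decrements commute. *)
Lemma deriv_count_poly a m i :
  (count_poly a m i)^`() = - (count_poly a m.-1 (map predn i) *+ m).
Proof.
elim: m i => [|m IH] i /=; first by rewrite -polyC_natr derivC mulr0n oppr0.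
rewrite raddf_sum; under eq_bigr do rewrite /= derivM deriv_cell_width IH.
rewrite big_split /= big_ord_recl /= mulN1r decr_from0 big1 ?addr0; last first.
  by move=> c _; rewrite oppr0 mul0r.
rewrite mulrS opprD; congr (_ + _).
case: m {IH} => [|m].
  by rewrite big1 ?mulr0n ?oppr0// => c _; rewrite mulr0n oppr0 mulr0.
rewrite /= -sumrMnl -sumrN; apply: eq_bigr => c _.
by rewrite mulrN mulrnAr decr_from_predn.
Qed.

(** A zero demand constrains nothing and stays zero, so cells 0 and 1 merge: their widths add up to
    that of cell 0 for [a]. *)
Lemma count_poly_cons0 (a1 : R) a m i :
  count_poly (a1 :: a) m (0%N :: i) = count_poly a m i.
Proof.
elim: m i => //= m IH i; rewrite big_ord_recl big_ord_recl /=.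
rewrite [RHS]big_ord_recl !decr_from0 /= addrA.
have -> : decr_from (bump 0 0) (0%N :: i) = 0%N :: map predn i.
  by rewrite /decr_from /= take0 drop0.
rewrite -mulrDl IH; congr (_ * _ + _).
  by rewrite /cell_width /= addrC addrA subrK.
apply: eq_bigr => c _.
by rewrite -(IH (decr_from _ i)).
Qed.

(** At [a1] the first cell has width 0, and points in the other cells leave the demand [i1]
    untouched. *)
Lemma count_poly_horner0 (a1 : R) a m (i1 : nat) i :
  (0 < i1)%N -> (count_poly (a1 :: a) m (i1 :: i)).[a1] = 0.
Proof.
move=> i0; elim: m i => [|m IH] i.
  by rewrite /= eq_sym gtn_eqF //= horner0.
rewrite /= horner_sum big1// => -[[|c] /= cs] _; rewrite hornerM.
  by rewrite /cell_width /= hornerD hornerN hornerC hornerX subrr mul0r.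
by rewrite IH mulr0.
Qed.

End count_poly.

(** * Taylor's formula for counting polynomials *)

Section integral.
Context {R : realType}.
Implicit Types (a : seq R) (i : seq nat).
Local Notation mu := (@lebesgue_measure R).

Let invf_fact_pred n : (0 < n)%N -> n`!%:R^-1 * n%:R = n.-1`!%:R^-1 :> R.
Proof.
case: n => // n _.
by rewrite factS natrM invfM mulrAC mulVf ?mul1r ?pnatr_eq0.
Qed.

Lemma integral_deriv_poly (p : {poly R}) (x y : R) : x <= y ->
  (\int[mu]_(z in `[x, y]) (p^`().[z])%:E = (p.[y] - p.[x])%:E)%E.
Proof.
rewrite le_eqVlt => /predU1P[<-|xy].
  by rewrite set_itv1 integral_set1 subrr.
rewrite (@continuous_FTC2 _ _ (horner p)) ?EFinB//.
- by apply: continuous_subspaceT => z; exact: continuous_horner.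
- split.
  + by move=> z _; exact: derivable_horner.
  + by apply: cvg_at_right_filter; exact: continuous_horner.
  + by apply: cvg_at_left_filter; exact: continuous_horner.
- by move=> z _; rewrite derivE.
Qed.

(* Taylor's formula with integral remainder: the scaled polynomials G_j are
   successive derivatives, up to sign, and those of index below r vanish at
   a1. *)
Lemma integral_count_poly (a1 y : R) a m (r : nat) i :
  (0 < r <= m)%N -> y <= a1 ->
  (\int[mu]_(x in `[y, a1])
     ((x - y) ^+ r.-1 / (r.-1)`!%:R *
      ((count_poly a (m - r) (map (subn^~ r) i)).[x] / (m - r)`!%:R))%:E =
   ((count_poly (a1 :: a) m (r :: i)).[y] / m`!%:R)%:E)%E.
Proof.
case: r => // r /= rm ya1.
pose G j : {poly R} := (m - j)`!%:R^-1 *: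
  count_poly (a1 :: a) (m - j) (map (subn^~ j) (r.+1 :: i)).
have dG j : (j < m)%N -> (G j)^`() = - G j.+1.
  move=> jm; rewrite /G derivZ deriv_count_poly scalerN; congr (- _).
  have -> : [seq x.-1 | x <- [seq (x - j)%N | x <- r.+1 :: i]] =
      [seq (x - j.+1)%N | x <- r.+1 :: i].
    by rewrite -map_comp; apply: eq_map => x /=; rewrite subnS.
  rewrite subnS -[count_poly _ _ _ *+ _]scaler_nat scalerA; congr (_ *: _).
  by rewrite invf_fact_pred ?subn_gt0.
pose pw j : {poly R} := j`!%:R^-1 *: ('X - y%:P) ^+ j.
have dpw j : (pw j.+1)^`() = pw j.
  rewrite /pw derivZ deriv_exp derivXsubC mul1r /=.
  rewrite -[_ ^+ j *+ _]scaler_nat scalerA.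
  by rewrite invf_fact_pred.
have dpw0 : (pw 0)^`() = 0 by rewrite /pw expr0 derivZ derivC scaler0.
(* The derivative of [T q.+1] telescopes to [- (pw q * G q.+1)], so [- T r.+1] is an antiderivative
   of the integrand. *)
pose T q := \sum_(j < q) pw j * G j.
have dT q : (q < m)%N -> (T q.+1)^`() = - (pw q * G q.+1).
  elim: q => [|q IH] qm.
    by rewrite /T big_ord1 derivM dpw0 mul0r add0r dG// mulrN.
  rewrite {1}/T big_ord_recr /= derivD -/(T q.+1) IH ?(ltnW qm)//.
  by rewrite derivM dpw dG// mulrN addrA addNr add0r.
transitivity (\int[mu]_(x in `[y, a1]) ((- T r.+1)^`().[x])%:E)%E.
  apply: eq_integral => x _; congr (_%:E).
  rewrite derivN dT// opprK hornerM /pw /G !hornerZ horner_exp hornerXsubC /=.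
  by rewrite subnn count_poly_cons0; congr (_ * _); rewrite mulrC.
rewrite integral_deriv_poly//; congr (_%:E).
(* At [a1] every [G j] with [j <= r] vanishes; at [y] the powers of [x - y] leave only the term
   [j = 0]. *)
rewrite !hornerN !horner_sum big1 ?sub0r ?oppr0.
  rewrite opprK add0r big_ord_recl big1 ?addr0 /= => [|j _]; last first.
    rewrite hornerM /pw hornerZ horner_exp hornerXsubC subrr expr0n.
    by rewrite mulr0 mul0r.
  rewrite hornerM /pw /G !hornerZ expr0 hornerC fact0 invr1 !mul1r !subn0 mulrC.
  congr ((count_poly _ _ (_ :: _)).[_] / _).
  by apply: map_id_in => x _; rewrite subn0.
move=> j _; rewrite hornerM !hornerZ.
rewrite (_ : (count_poly _ _ _).[a1] = 0) ?mulr0//.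
by apply: count_poly_horner0; rewrite subn_gt0.
Qed.

End integral.

(** * Iterated integration over ordered domains *)

(** In dimension [k.+1], [lebesgue_tuple] is the image of a product measure, so a change of
    variables and Tonelli's theorem apply. *)
Lemma integral_lebesgue_tupleS (R : realType) k (f : k.+1.-tuple R -> \bar R) :
  measurable_fun setT f -> (forall x, 0 <= f x)%E ->
  (\int[@lebesgue_tuple R k.+1]_x f x =
   \int[@lebesgue_measure R]_x \int[@lebesgue_tuple R k]_t
     f (tuple_cons (x, t)))%E.
Proof.
move=> mf f0.
pose m1 : {sigma_finite_measure set (measurableTypeR R) -> \bar R} :=
  @lebesgue_measure R.
pose m2 : {sigma_finite_measure set (k.-tuple R) -> \bar R} :=
  @lebesgue_tuple R k.
pose m := (m1 \x m2)%E :
  {measure set (measurableTypeR R * k.-tuple R) -> \bar R}.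
transitivity (\int[pushforward m (@tuple_cons R k)]_x f x)%E; first by [].
have mc : measurable_fun [set: measurableTypeR R * k.-tuple R]
    (@tuple_cons R k).
  apply: measurable_cons; [exact: measurable_fst|exact: measurable_snd].
rewrite (ge0_integral_pushforward mc m measurableT mf); last first.
  by move=> x _; exact: f0.
rewrite preimage_setT /m (@fubini_tonelli1 _ _ _ _ _ m1 m2)//.
  exact: (measurableT_comp mf mc).
by move=> x; exact: f0.
Qed.

Section gap_product.
Context {R : realType}.

(* The product part of order_density with arbitrary conventional endpoints i0
   and y, a family closed under removing the first coordinate. *)
Definition gap_prod (N i0 : nat) (y : R) (i : seq nat) (x : seq R) : R :=
  \prod_(s < (size i).+1)
    ((with_ends y 1 x s.+1 - with_ends y 1 x s) ^+
       (with_ends i0 N.+1 i s.+1 - with_ends i0 N.+1 i s - 1)%N /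
     ((with_ends i0 N.+1 i s.+1 - with_ends i0 N.+1 i s - 1)`!)%:R).

(** With a start [y] in place of 0, fixing the first coordinate leaves a domain of the same kind;
    [y = 0] gives [ordered_domain]. *)
Definition ordered_domain_from (k : nat) (y : R) (a : k.-tuple R) :
    set (k.-tuple R) :=
  [set x : k.-tuple R | path <=%R y x /\ forall s : 'I_k, tnth x s <= tnth a s].

Lemma gap_prod_nil N i0 y :
  gap_prod N i0 y [::] [::] = (1 - y) ^+ (N - i0) / (N - i0)`!%:R.
Proof.
by rewrite /gap_prod big_ord1 /with_ends /= -subnDA addn1 subSS.
Qed.

Lemma gap_prod_cons N i0 y i1 i x1 x :
  gap_prod N i0 y (i1 :: i) (x1 :: x) =
  (x1 - y) ^+ (i1 - i0).-1 / ((i1 - i0).-1)`!%:R * gap_prod N i1 x1 i x.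
Proof. by rewrite /gap_prod big_ord_recl /with_ends /= subn1. Qed.

Lemma with_ends_gap_ge0 (y : R) (x : seq R) s :
  path <=%R y (rcons x 1) -> (s <= size x)%N ->
  0 <= with_ends y 1 x s.+1 - with_ends y 1 x s.
Proof.
move=> /(pathP 1) xP sx; rewrite subr_ge0 /with_ends /=.
have := xP s; rewrite size_rcons ltnS => /(_ sx).
rewrite nth_rcons_default; apply: le_trans.
by case: s sx => // s sx; rewrite /= nth_rcons_default.
Qed.

Lemma gap_prod_ge0 N i0 y (i : seq nat) (x : seq R) :
  size i = size x -> path <=%R y (rcons x 1) -> 0 <= gap_prod N i0 y i x.
Proof.
move=> ix xP; apply: prodr_ge0 => s _; rewrite divr_ge0// exprn_ge0//.
by apply: with_ends_gap_ge0 => //; rewrite -ix -ltnS.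
Qed.

(** The bound to be supplied is on the last coordinate: [x_k <= a_k <= 1], or [y <= 1] if
    [k = 0]. *)
Lemma ordered_domain_from_path k y (a x : k.-tuple R) :
  path <=%R y (rcons a 1) -> ordered_domain_from y a x ->
  path <=%R y (rcons x 1).
Proof.
move=> aP [xP xa]; rewrite rcons_path xP /=.
case: k a x aP xP xa => [|k] a x aP xP xa.
  by move: aP; rewrite (tuple0 a) (tuple0 x) /= andbT.
have -> : last y x = tnth x ord_max.
  by rewrite (tnth_nth y) /= (last_nth y) size_tuple.
apply: le_trans (xa _) _.
move: aP; rewrite rcons_path => /andP[_]; apply: le_trans.
by rewrite (tnth_nth y) /= (last_nth y) size_tuple.
Qed.

Lemma measurable_with_ends k (y b : R) j :
  measurable_fun setT (fun x : k.-tuple R => with_ends y b x j).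
Proof.
case: j => [|j]; first exact: measurable_cst.
have [jk|jk] := ltnP j k; last first.
  rewrite (_ : (fun _ => _) = cst b); first exact: measurable_cst.
  by apply/funext => x; rewrite /with_ends /= nth_default ?size_tuple.
rewrite (_ : (fun _ => _) = (fun x => tnth x (Ordinal jk))).
  exact: measurable_tnth.
by apply/funext => x; rewrite (tnth_nth b).
Qed.

Lemma measurable_gap_prod k N i0 y (i : seq nat) :
  measurable_fun setT (fun x : k.-tuple R => gap_prod N i0 y i x).
Proof.
apply: measurable_prod => s _; apply: measurable_funM => //.
apply: measurable_funX; apply: measurable_funB; exact: measurable_with_ends.
Qed.

Lemma measurable_ordered_domain_from k y (a : k.-tuple R) :
  measurable (ordered_domain_from y a).
Proof.
rewrite (_ : ordered_domain_from y a =
  (\bigcap_(j in [set: 'I_k])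
    [set x : k.-tuple R | with_ends y y x j <= with_ends y y x j.+1]) `&`
  (\bigcap_(j in [set: 'I_k]) [set x : k.-tuple R | tnth x j <= tnth a j])).
  have mle (f g : k.-tuple R -> R) : measurable_fun setT f ->
      measurable_fun setT g -> measurable [set x | f x <= g x].
    move=> mf mg; have := measurable_fun_ler mf mg.
    by move=> /(_ measurableT [set true] I); rewrite setTI preimage_true.
  apply: measurableI.
    apply: fin_bigcap_measurable => [|j _]; first exact: finite_finset.
    by apply: mle; exact: measurable_with_ends.
  apply: fin_bigcap_measurable => [|j _]; first exact: finite_finset.
  by apply: mle; [exact: measurable_tnth|exact: measurable_cst].
apply/seteqP; split => x /=.
  move=> [/(pathP y) xP xa]; split => [j _|j _]; last exact: xa.
  by apply: xP; rewrite size_tuple.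
move=> [xP xa]; split => [|s]; last exact: (xa s I).
by apply/(pathP y) => j; rewrite size_tuple => jk; exact: (xP (Ordinal jk) I).
Qed.

Lemma ordered_domain_from_cons k y (a : k.+1.-tuple R) x1 (x : k.-tuple R) :
  ordered_domain_from y a (tuple_cons (x1, x)) <->
  y <= x1 <= thead a /\ ordered_domain_from x1 [tuple of behead a] x.
Proof.
have aS (s : 'I_k) : tnth a (lift ord0 s) = tnth [tuple of behead a] s.
  by rewrite {1}(tuple_eta a) tnthS.
split.
  move=> [/= /andP[yx xP] xa]; split; first by rewrite yx; exact: (xa ord0).
  split=> // s; have := xa (lift ord0 s).
  by rewrite tnthS aS.
move=> [/andP[yx xa1] [xP xa]]; split => /=; first by rewrite yx.
move=> s; case: (unliftP ord0 s) => [j ->|->] //.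
by rewrite tnthS aS; exact: xa.
Qed.

(** Induction on [k] for all [i0] and [y]: once [x_1] is fixed, the remaining integral has the same
    form with starts [i_1] and [x_1], and the integral over [x_1] is Taylor's formula. *)
Lemma integral_gap_prod k N i0 y (a : k.-tuple R) (i : k.-tuple nat) :
  path ltn i0 (rcons i N.+1) -> path <=%R y (rcons a 1) ->
  (\int[@lebesgue_tuple R k]_(x in ordered_domain_from y a)
     (gap_prod N i0 y i x)%:E =
   ((count_poly a (N - i0) (map (subn^~ i0) i)).[y] / (N - i0)`!%:R)%:E)%E.
Proof.
elim: k i0 y a i => [|k IH] i0 y a i iP aP.
  rewrite (tuple0 a) (tuple0 i) /= integral_dirac; last 2 first.
    exact: measurable_ordered_domain_from.
    apply/measurable_EFinP; apply: measurable_funTS.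
    exact: measurable_gap_prod.
  rewrite diracE mem_set ?mul1e /=; last by split => // -[].
  rewrite gap_prod_nil count_poly_nil horner_exp.
  by rewrite hornerD hornerN hornerX hornerC.
have mD := measurable_ordered_domain_from y a.
have mg : measurable_fun (ordered_domain_from y a)
    (fun x : k.+1.-tuple R => (gap_prod N i0 y i x)%:E).
  apply/measurable_EFinP; apply: measurable_funTS.
  exact: measurable_gap_prod.
have g0 x : ordered_domain_from y a x -> (0 <= (gap_prod N i0 y i x)%:E)%E.
  move=> xD; rewrite lee_fin gap_prod_ge0 ?size_tuple//.
  exact: ordered_domain_from_path xD.
rewrite integral_mkcond integral_lebesgue_tupleS; last 2 first.
- exact/(measurable_restrictT _ mD).
- by move=> x; rewrite patchE; case: ifPn => // /set_mem/g0.
have aE : tval a = thead a :: behead a by rewrite {1}(tuple_eta a).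
have iE : tval i = thead i :: behead i by rewrite {1}(tuple_eta i).
move: iP aP; rewrite aE iE /= => /andP[i01 iP] /andP[ya1 aP].
have i1N : (thead i <= N)%N.
  have := order_path_min ltn_trans iP; rewrite all_rcons /= ltnS.
  by move=> /andP[].
transitivity (\int[lebesgue_measure]_(x in `[y, thead a])
  ((x - y) ^+ (thead i - i0).-1 / ((thead i - i0).-1)`!%:R *
   ((count_poly (behead a) (N - thead i)
      (map (subn^~ (thead i)) (behead i))).[x] / (N - thead i)`!%:R))%:E)%E.
  rewrite [RHS]integral_mkcond; apply: eq_integral => x _.
  rewrite patchE; case: ifPn => [/set_mem|/negP xya].
    rewrite /= in_itv/= => /andP[yx xa].
    rewrite EFinM -(IH (thead i) x [tuple of behead a] [tuple of behead i])//;
      last exact: (path_le le_trans xa aP).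
    rewrite -ge0_integralZl; last 4 first.
    - exact: measurable_ordered_domain_from.
    - apply/measurable_EFinP; apply: measurable_funTS.
      exact: measurable_gap_prod.
    - move=> t tD; rewrite lee_fin gap_prod_ge0 ?size_tuple//.
      by apply: ordered_domain_from_path tD; exact: (path_le le_trans xa aP).
    - by rewrite lee_fin divr_ge0// exprn_ge0// subr_ge0.
    rewrite [RHS]integral_mkcond; apply: eq_integral => t _.
    rewrite !patchE; case: ifPn => [/set_mem/ordered_domain_from_cons[_ tD]|].
      by rewrite mem_set// gap_prod_cons EFinM.
    move=> /negP tD; rewrite memNset// => tD'; apply: tD; apply/mem_set.
    by apply/ordered_domain_from_cons; rewrite yx xa.
  apply: integral0_eq => t _; rewrite patchE memNset//.
  move=> /ordered_domain_from_cons[xya' _]; apply: xya.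
  by rewrite inE/= in_itv.
(* The formula is used for [N - i0] points with first demand [i_1 - i0]; lowering [i_s - i0] by that
   amount gives [i_s - i_1]. *)
have := @integral_count_poly R (thead a) y (behead a) (N - i0) (thead i - i0)
  (map (subn^~ i0) (behead i)).
rewrite subn_gt0 i01 leq_sub2r// => /(_ isT ya1) <-.
apply: eq_integral => x _; congr (_ * ((count_poly _ _ _).[_] / _`!%:R))%:E.
- lia.
- by rewrite -map_comp; apply: eq_map => j /=; lia.
- lia.
Qed.

End gap_product.

(** * Joint law of the cell counts of independent samples *)

Section count_probability.
Context d (Omega : measurableType d) (R : realType) (P : probability Omega R).
Context d' (T : measurableType d') (N : nat) (X : 'I_N -> {RV P >-> T}).
Variables (c : T -> nat) (a : seq R).
Hypothesis X_indep : mutually_independent X.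
Hypothesis c_le : forall x, (c x <= size a)%N.
Hypothesis measurable_cell : forall l, measurable [set x | c x = l].
Hypothesis P_cell : forall j (l : 'I_(size a).+1),
  P [set w | c (X j w) = l] = (cell_width a l).[0]%:E.

(* The points of index at least m are constrained by B individually, so that
   fixing the cell of point m - 1 gives an event of the same form with m - 1. *)
Let count_event (m : nat) (i : seq nat) (B : 'I_N -> set T) : set Omega :=
  [set w | (forall s, (s < size i)%N ->
      (nth 0 i s <= \sum_(j < N | (j < m)%N) (c (X j w) <= s))%N) /\
    forall j : 'I_N, (m <= j)%N -> B j (X j w)].

Let count_event0 i B : count_event 0 i B =
  if all (eq_op 0%N) i
  then [set w | forall j, j \in [set: 'I_N]%SET -> B j (X j w)] else set0.
Proof.
apply/seteqP.
case: ifPn => [/allP i0|/allPn[n /(nthP 0%N)[s si <-] n0]]; split => w //=.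
- by move=> [_ Bw] j _; exact: Bw.
- move=> Bw; split=> [s si|j _]; last by apply: Bw; rewrite inE.
  by rewrite -(eqP (i0 _ (mem_nth 0%N si))).
- by move=> [/(_ s si)]; rewrite big_pred0_eq leqn0 eq_sym (negPf n0).
Qed.

(** Split by the cell [l] of point [m]. In [count_event m.+1] this point is counted but not
    constrained individually, so its entry of [B] is free to record the cell. *)
Let count_eventS m (mN : (m < N)%N) i B :
  size i = size a ->
  count_event m.+1 i B = \big[setU/set0]_(l < (size a).+1)
    count_event m (decr_from l i)
      (fun j => if j == Ordinal mN then [set x | c x = l] else B j).
Proof.
move=> ia; pose jm := Ordinal mN.
have cS w s : (\sum_(j < N | (j < m.+1)%N) (c (X j w) <= s) =
    (c (X jm w) <= s) + \sum_(j < N | (j < m)%N) (c (X j w) <= s))%N.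
  rewrite (bigD1 jm) //=; congr addn; apply: eq_bigl => j.
  by rewrite ltnS -(inj_eq val_inj) /= [RHS]ltn_neqAle andbC.
apply/seteqP; split => w.
  move=> [iw Bw]; rewrite -bigcup_seq /=.
  have cl : (c (X jm w) < (size a).+1)%N by rewrite ltnS.
  exists (Ordinal cl); first by rewrite /= mem_index_enum.
  split => [s|j].
    rewrite size_decr_from nth_decr_from leq_subLR => si.
    by rewrite -cS; exact: iw.
  case: ifPn => [/eqP -> //|jNm mj].
  apply: Bw; rewrite ltn_neqAle mj andbT eq_sym.
  by apply: contra jNm => /eqP jm'; exact/eqP/val_inj.
rewrite -bigcup_seq /= => -[l _ [iw Bw]].
have := Bw jm (leqnn _); rewrite eqxx /= => cl; split => [s si|j mj].
  rewrite cS cl -leq_subLR -nth_decr_from; apply: iw.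
  by rewrite size_decr_from.
have := Bw j (ltnW mj); rewrite ifN//.
by apply: contraTneq mj => ->; rewrite ltnn.
Qed.

(** Independence enters at [m = 0], where all points are constrained individually; the step sums
    over the disjoint cells of point [m] and mirrors the recursion of [count_poly]. *)
Let probability_count_event m i B : (m <= N)%N -> size i = size a ->
  (forall j, measurable (B j)) ->
  measurable (count_event m i B) /\
  P (count_event m i B) = ((count_poly a m i).[0] *
    \prod_(j < N | (m <= j)%N) fine (P [set w | B j (X j w)]))%:E.
Proof.
have mX j (A : set T) : measurable A -> measurable [set w | A (X j w)].
  by move=> mA; exact: (measurable_funPTI (X j) mA).
elim: m i B => [|m IH] i B mN ia mB.
  rewrite count_event0 /=; case: ifPn => _; last first.
    by rewrite horner0 mul0r measure0.
  split; last first.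
    rewrite X_indep// hornerC mul1r -prodEFin; apply: eq_big => [j|j _].
      by rewrite inE.
    by rewrite fineK// fin_num_measure//; exact: mX.
  rewrite (_ : [set _ | _] = \bigcap_(j in [set: 'I_N]) [set w | B j (X j w)]).
    by apply: fin_bigcap_measurable => [|j _]; [exact: finite_finset|exact: mX].
  apply/seteqP; split => w Bw j jN; last exact: (Bw j).
  by apply: (Bw j); rewrite inE.
pose jm := Ordinal mN.
pose B' (l : nat) j := if j == jm then [set x | c x = l] else B j.
have mB' l j : measurable (B' l j) by rewrite /B'; case: ifPn.
have IHl (l : 'I_(size a).+1) := IH (decr_from l i) (B' l) (ltnW mN)
  (etrans (size_decr_from l i) ia) (mB' l).
rewrite count_eventS//; split.
  by apply: bigsetU_measurable => l _; have [] := IHl l.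
rewrite measure_bigsetU_ord; last 2 first.
- by move=> l; have [] := IHl l.
- apply/trivIsetP => l l' _ _ ll'; rewrite -subset0 => w [[_ Bl] [_ Bl']].
  move: (Bl jm (leqnn _)) (Bl' jm (leqnn _)); rewrite /= eqxx /= => -> /val_inj.
  exact/eqP.
rewrite /= horner_sum mulr_suml -sumEFin; apply: eq_bigr => l _.
have [_ ->] := IHl l; congr (_%:E).
rewrite hornerM (bigD1 jm) ?leqnn//= mulrA; congr (_ * _).
- by rewrite mulrC /B' eqxx P_cell.
- apply: eq_big => [j|j /andP[_ jNm]]; last by rewrite /B' (negPf jNm).
  by rewrite -(inj_eq val_inj) /= [RHS]ltn_neqAle andbC eq_sym.
Qed.

Lemma probability_count i : size i = size a ->
  P [set w | forall s, (s < size i)%N ->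
      (nth 0 i s <= \sum_(j < N) (c (X j w) <= s))%N] =
  (count_poly a N i).[0]%:E.
Proof.
move=> ia; have [_] := @probability_count_event N i (fun=> setT) (leqnn N) ia
  (fun=> measurableT).
rewrite big_pred0 ?mulr1; last by move=> j; rewrite leqNgt ltn_ord.
have SN w s : (\sum_(j < N | (j < N)%N) (c (X j w) <= s) =
    \sum_(j < N) (c (X j w) <= s))%N.
  by apply: eq_bigl => j; rewrite ltn_ord.
move=> <-; congr (P _); apply/seteqP; split => w /=.
  by move=> iw; split => // s si; rewrite SN; exact: iw.
by move=> [iw _] s si; rewrite -SN; exact: iw.
Qed.

End count_probability.

(** * Order statistics as counts *)

(** In a sorted list a down-set occupies an initial segment, whose length is its count. *)
Lemma nth_sorted_count disp (T : orderType disp) (x0 : T) (p : pred T)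
    (s : seq T) j :
  (forall x y, (x <= y)%O -> p y -> p x) -> sorted <=%O s -> (j < size s)%N ->
  p (nth x0 s j) = (j < count p s)%N.
Proof.
move=> pdown; elim: s j => [|x s IH] // j xs js.
have ss := path_sorted xs.
case: (boolP (p x)) => px; last first.
  have np y : y \in x :: s -> ~~ p y.
    rewrite inE => /predU1P[->//|ys]; apply: contra px; apply: pdown.
    exact: (allP (order_path_min le_trans xs)).
  rewrite (negPf (np _ (mem_nth _ js))); apply/esym/negbTE.
  suff /eqP -> : count p (x :: s) == 0%N by [].
  by rewrite -leqn0 leqNgt -has_count -all_predC; apply/allP => y /np.
case: j js => [|j] js; rewrite /= px//.
exact: IH.
Qed.

Lemma order_stat_count (R : realType) N (p : pred R) (v : 'I_N -> R) i :
  (forall x y, x <= y -> p y -> p x) -> (0 < i <= N)%N ->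
  p (order_stat v i) = (i <= \sum_(j < N) p (v j))%N.
Proof.
case: i => // i pdown /= iN; rewrite /order_stat /=.
rewrite nth_sorted_count//; last by rewrite size_sort size_map size_enum_ord.
congr leq; rewrite (permP (permEl (perm_sort _ _))).
by rewrite -sum1_count big_map big_mkcond /= big_enum.
Qed.

(** * Measurability of compact sets *)

(** The complement is open, hence a union of countably many rational boxes. This lets a function
    measurable on [Q] be extended measurably to the whole space. *)
Lemma measurable_compact_tuple (R : realType) n (Q : set (n.-tuple R)) :
  compact_tuple Q -> measurable Q.
Proof.
move=> cQ.
have /closed_openC oQ : closed [set rv_of_tuple x | x in Q].
  by apply: compact_closed => //; exact: norm_hausdorff.
rewrite -[Q]setCK; apply: measurableC.
pose box (r : {ffun 'I_n -> rat * rat}) : set (n.-tuple R) :=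
  [set x | forall j, ratr (r j).1 < tnth x j < ratr (r j).2].
have mbox r : measurable (box r).
  rewrite (_ : box r = \bigcap_(j in [set: 'I_n])
      (@tnth n R)^~ j @^-1` `]ratr (r j).1, ratr (r j).2[).
    apply: fin_bigcap_measurable => [|j _]; first exact: finite_finset.
    by rewrite -[X in measurable X]setTI; exact: measurable_tnth.
  apply/seteqP; split => [x rx j _|x rx j]; first exact: (rx j).
  exact: (rx j I).
rewrite (_ : ~` Q = \bigcup_(r : {ffun 'I_n -> rat * rat})
    (if `[< box r `<=` ~` Q >] then box r else set0)).
  apply: countable_bigcupT_measurable => [|r]; first exact: countableP.
  by case: asboolP.
apply/seteqP; split => x; last first.
  by move=> [r _]; case: asboolP => // rQ /rQ.
move=> Qx.
have : nbhs (rv_of_tuple x) (~` [set rv_of_tuple x | x in Q]).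
  apply: open_nbhs_nbhs; split => // -[y Qy] /rowP yx; apply: Qx.
  suff <- : y = x by [].
  by apply: eq_from_tnth => j; have := yx j; rewrite !mxE.
move=> [B Bx BQ].
(* A neighbourhood of a row vector contains a product of neighbourhoods of its entries, and each of
   these contains a rational interval around the entry. *)
have /choice[r rP] (j : 'I_n) : exists r : rat * rat,
    ratr r.1 < tnth x j < ratr r.2 /\
    forall z, ratr r.1 < z < ratr r.2 -> B ord0 j z.
  have := Bx ord0 j; rewrite mxE => /nbhs_ballP[e /= e0 eB].
  have [q1 /[!in_itv] /= /andP[q1l q1r]] :
    exists q, ratr q \in `](tnth x j - e), (tnth x j)[.
    by apply: rat_in_itvoo; lra.
  have [q2 /[!in_itv] /= /andP[q2l q2r]] :
    exists q, ratr q \in `](tnth x j), (tnth x j + e)[.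
    by apply: rat_in_itvoo; lra.
  exists (q1, q2) => /=; rewrite q1r q2l; split => // z /andP[z1 z2].
  by apply: eB; rewrite /ball /= ltr_distlC; apply/andP; split; lra.
exists [ffun j => r j] => //; case: asboolP => [_ /= j|].
  by rewrite ffunE; have [] := rP j.
case=> y yr Qy; apply: (BQ (rv_of_tuple y)); last by exists y.
move=> i j; rewrite mxE (ord1 i); apply: (rP j).2.
by have := yr j; rewrite ffunE.
Qed.

(** * The numbers tau and the distribution function *)

Section tau.
Context d (Omega : measurableType d) (R : realType) (P : probability Omega R).
Variable V : {RV P >-> R}.
Implicit Types s t : R.
Let F (x : R) : R := fine (P [set w | V w <= x]).

Let mle x : measurable [set w | V w <= x].
Proof.
rewrite (_ : [set _ | _] = V @^-1` `]-oo, x]).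
  exact: measurable_funPTI.
by apply/seteqP; split => w; rewrite /= in_itv.
Qed.

Let FE x : P [set w | V w <= x] = (F x)%:E.
Proof. by rewrite fineK// fin_num_measure. Qed.

Let F_cdf : F = fine \o cdf V.
Proof.
apply/funext => x; rewrite /F /= /cdf /distribution /pushforward.
by congr (fine (P _)); apply/seteqP; split => w; rewrite /= in_itv.
Qed.

Lemma fine_cdf_nondecreasing x y : x <= y -> F x <= F y.
Proof.
move=> xy; rewrite -lee_fin -!FE; apply: le_measure; rewrite ?inE//.
by move=> w /= /le_trans; exact.
Qed.

Let F_ge0 x : 0 <= F x. Proof. by rewrite fine_ge0. Qed.

Let F_le1 x : F x <= 1.
Proof. by rewrite -lee_fin -FE probability_le1. Qed.

Lemma measurable_fine_cdf : measurable_fun setT F.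
Proof.
by apply: nondecreasing_measurable => // x y; exact: fine_cdf_nondecreasing.
Qed.

Let has_ubound_image t : has_ubound [set F x | x in [set x | F x < t]].
Proof. by exists 1 => _ [x _ <-]. Qed.

Let tau_ub t x : F x < t -> F x <= tau F t.
Proof. by move=> xt; apply: ub_le_sup => //; exists x. Qed.

(** Nonnegativity of [t] covers the empty set, whose supremum is 0. *)
Lemma tau_le t : 0 <= t -> tau F t <= t.
Proof.
move=> t0; rewrite /tau.
have [->|ne] := eqVneq [set F x | x in [set x | F x < t]] set0.
  by rewrite sup0.
by apply: ge_sup => [|_ [x /ltW xt <-]//]; exact/set0P.
Qed.

Lemma tau_ge0 t : 0 <= tau F t.
Proof.
rewrite /tau; have [->|/set0P[_ [x xt _]]] :=
  eqVneq [set F x | x in [set x | F x < t]] set0; first by rewrite sup0.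
exact: le_trans (F_ge0 x) (tau_ub xt).
Qed.

Lemma tau_le1 t : tau F t <= 1.
Proof.
rewrite /tau; have [->|ne] := eqVneq [set F x | x in [set x | F x < t]] set0.
  by rewrite sup0.
by apply: ge_sup => [|_ [x _ <-]//]; exact/set0P.
Qed.

Lemma tau_nondecreasing s t : s <= t -> tau F s <= tau F t.
Proof.
move=> st; rewrite {1}/tau.
have [->|ne] := eqVneq [set F x | x in [set x | F x < s]] set0.
  by rewrite sup0 tau_ge0.
apply: ge_sup => [|_ [x xs <-]]; first exact/set0P.
exact/tau_ub/(lt_le_trans xs).
Qed.

(** If tau were below [t], a value [v] strictly between them would be attained by the intermediate
    value theorem, and [v < t] forces [v <= tau]. *)
Lemma tau_continuous t : 0 <= t <= 1 -> continuous F -> tau F t = t.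
Proof.
move=> /andP[t0 t1] cF; apply/eqP; rewrite eq_le tau_le//= leNgt.
apply/negP => taut; pose v := (tau F t + t) / 2.
have [vt tauv] : v < t /\ tau F t < v by rewrite /v; split; lra.
have v0 : 0 < v by apply: le_lt_trans tauv; exact: tau_ge0.
have [a Fa] : exists a, F a < v.
  have F0 : F x @[x --> -oo] --> 0.
    by rewrite F_cdf; apply: fine_cvg; exact: cvg_cdfNy0.
  suff /filter_ex : \forall x \near -oo, F x < v by [].
  exact: cvgr_lt F0 _ v0.
have [b Fb] : exists b, v < F b.
  have F1 : F x @[x --> +oo] --> (1 : R).
    by rewrite F_cdf; apply: fine_cvg; exact: cvg_cdfy1.
  suff /filter_ex : \forall x \near +oo, v < F x by [].
  exact: cvgr_gt F1 _ (lt_le_trans vt t1).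
have ab : a <= b.
  by rewrite leNgt; apply/negP => /ltW/fine_cdf_nondecreasing; lra.
have [||x _ Fx] := @IVT R F a b v ab.
- exact: continuous_subspaceT.
- by rewrite ge_min le_max (ltW Fa) (ltW Fb) orbT.
by have := @tau_ub t x; rewrite Fx => /(_ vt); lra.
Qed.

(** For a nondecreasing sequence cofinal in the down-set, the event is the increasing union of the
    [{V <= x_n}]; continuity from below applies, with each [F (x_n) <= tau]. *)
Let P_le_tau t (x_ : nat -> R) : {homo x_ : n m / (n <= m)%N >-> n <= m} ->
  (forall n, F (x_ n) < t) -> (forall y, F y < t -> exists n, y <= x_ n) ->
  (P [set w | (F (V w) < t)%R] <= (tau F t)%:E)%E.
Proof.
move=> xnd xt xcof.
rewrite (_ : [set _ | _] = \bigcup_n [set w | V w <= x_ n]); last first.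
  apply/seteqP; split => w /=; first by move=> /xcof[n Vn]; exists n.
  by move=> [n _ /fine_cdf_nondecreasing/le_lt_trans]; apply; exact: xt.
have Fn : P [set w | V w <= x_ n] @[n --> \oo] -->
    P (\bigcup_n [set w | V w <= x_ n]).
  apply: nondecreasing_cvg_mu => //; first exact: bigcup_measurable.
  by move=> m n mn; apply/subsetPset => w /= /le_trans; apply; exact: xnd.
rewrite -(cvg_lim _ Fn)//; apply: lime_le.
  by apply/cvg_ex; eexists; exact: Fn.
by apply: nearW => n; rewrite FE lee_fin; exact: tau_ub.
Qed.

(** Upper bound by exhibiting a cofinal sequence; lower bound because [{V <= x}] lies in the event
    whenever [F x < t]. *)
Lemma probability_fine_cdf_lt t : P [set w | F (V w) < t] = (tau F t)%:E.
Proof.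
have [A0|/set0P[x0 x0t]] := eqVneq [set x | F x < t] set0.
  rewrite /tau A0 image_set0 sup0 (_ : [set _ | _] = set0) ?measure0//.
  by rewrite -subset0 => w; rewrite -[set0 w]/(set0 (V w)) -A0.
have mA : measurable [set w | F (V w) < t].
  have := measurable_fun_ltr
    (measurableT_comp measurable_fine_cdf (measurable_funPT V))
    (measurable_cst t).
  by move=> /(_ measurableT [set true] I); rewrite setTI preimage_true.
apply/eqP; rewrite eq_le; apply/andP; split; last first.
  rewrite -(fineK (fin_num_measure P _ mA)) lee_fin; apply: ge_sup.
    by exists (F x0), x0.
  move=> _ [x xt <-]; rewrite -lee_fin -FE fineK ?fin_num_measure//.
  apply: le_measure; rewrite ?inE// => w /=.
  by move=> /fine_cdf_nondecreasing/le_lt_trans; exact.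
(* The down-set is the whole line, []-oo, b]] or []-oo, b[], with cofinal sequences [n], constant
   [b] and [b - 1/(n+1)] respectively. *)
have [uA|nuA] := pselect (has_ubound [set x | F x < t]); last first.
  apply: (@P_le_tau t (fun n => n%:R)) => [m n|n|y _]; first by rewrite ler_nat.
    rewrite ltNge; apply/negP => tn; apply: nuA; exists n%:R => y /= yt.
    by rewrite leNgt; apply/negP => /ltW/fine_cdf_nondecreasing; lra.
  by exists (Num.truncn y).+1; rewrite ltW// truncnS_gt.
pose b := sup [set x | F x < t].
have ub y : F y < t -> y <= b by move=> yt; exact: ub_le_sup.
have [bt|tb] := ltP (F b) t.
  by apply: (@P_le_tau t (fun=> b)) => // y yt; exists 0%N; exact: ub.
apply: (@P_le_tau t (fun n => b - n.+1%:R^-1)) => [m n mn|n|y yt].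
- by rewrite lerD2l lerN2 lef_pV2 ?posrE// ler_nat.
- have [|y yt by_] := @sup_adherent _ _ n.+1%:R^-1 _
    (conj (ex_intro _ x0 x0t) uA).
    by rewrite invr_gt0.
  exact: le_lt_trans (fine_cdf_nondecreasing (ltW by_)) yt.
- have yb : y < b.
    by rewrite lt_neqAle ub// andbT; apply: contraTneq yt => ->; rewrite -leNgt.
  have [n nb] := ltr_add_invr yb.
  by exists n; rewrite lerBrDr ltW.
Qed.

End tau.

(** * Integral of the order-statistics density *)

Lemma order_densityE (R : realType) (N k : nat) (i : k.-tuple nat)
    (x : k.-tuple R) :
  order_density N i x = N`!%:R * gap_prod N 0 0 i x.
Proof. by rewrite /order_density /gap_prod size_tuple. Qed.

Lemma integral_order_density (R : realType) (N k : nat) (i : k.-tuple nat)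
    (a : k.-tuple R) :
  path ltn 0%N (rcons i N.+1) -> path <=%R 0 (rcons a 1) ->
  (\int[@lebesgue_tuple R k]_(x in ordered_domain a) (order_density N i x)%:E =
   (count_poly a N i).[0]%:E)%E.
Proof.
move=> iP aP; have := integral_gap_prod iP aP; rewrite subn0 => H.
transitivity (N`!%:R%:E *
  ((count_poly a N [seq (x - 0)%N | x <- i]).[0] / N`!%:R)%:E)%E.
  rewrite -H -ge0_integralZl//.
  - by apply: eq_integral => x _; rewrite -EFinM order_densityE.
  - exact: measurable_ordered_domain_from.
  - apply/measurable_EFinP; apply: measurable_funTS.
    exact: measurable_gap_prod.
  - move=> x xD; rewrite lee_fin gap_prod_ge0 ?size_tuple//.
    exact: ordered_domain_from_path xD.
rewrite -EFinM mulrC divfK ?pnatr_eq0 -?lt0n ?fact_gt0//.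
by congr ((count_poly _ _ _).[_]%:E); apply: map_id_in => x _; rewrite subn0.
Qed.

Lemma path_rcons_between (T : eqType) (r : rel T) x0 b s :
  transitive r -> path r x0 (rcons s b) -> forall y, y \in s -> r x0 y && r y b.
Proof.
move=> r_trans; elim: s x0 => // x s IH x0 /= /andP[x0x xs] y.
rewrite inE => /predU1P[->|/(IH _ xs)/andP[xy ->]].
  rewrite x0x; have := order_path_min r_trans xs.
  by rewrite all_rcons => /andP[].
by rewrite (r_trans _ _ _ x0x xy).
Qed.

(** * Joint law of the order statistics *)

Section order_stat_law.
Context d (Omega : measurableType d) (R : realType) (P : probability Omega R).
Context d' (T : measurableType d') (N : nat) (X : 'I_N -> {RV P >-> T}).
Variables (v : T -> R) (V : {RV P >-> R}) (k : nat) (t : k.-tuple R).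
Hypothesis X_indep : mutually_independent X.
Hypothesis mv : measurable_fun setT v.
Hypothesis X_law : forall j (A : set R), measurable A ->
  P [set w | A (v (X j w))] = P [set w | A (V w)].
Hypothesis t_sorted : sorted <=%R t.

Let F (x : R) : R := fine (P [set w | V w <= x]).
Let a : seq R := [seq tau F r | r <- t].
(** Cells are cut by values of [F], not by points of the line: as [t] is sorted, [c x <= s] iff
    [F (v x) < t_s] (from 0), an event of probability [tau_s] even if [F] jumps. *)
Let c (x : T) : nat := count (fun r => r <= F (v x)) t.

Let c_le x : (c x <= size a)%N.
Proof. by rewrite size_map count_size. Qed.

Let c_leE x s : (s < k)%N -> (c x <= s)%N = (F (v x) < nth 0 t s).
Proof.
move=> sk; rewrite leqNgt ltNge; congr negb; apply/esym.
rewrite (nth_sorted_count 0 (p := fun r => r <= F (v x)))// ?size_tuple//.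
by move=> r r' /le_trans; exact.
Qed.

Let mFlt r : measurable [set y | F y < r].
Proof.
have := measurable_fun_ltr (measurable_fine_cdf V) (measurable_cst r).
by move=> /(_ measurableT [set true] I); rewrite setTI preimage_true.
Qed.

Let measurable_c_le s : measurable [set x | (c x <= s)%N].
Proof.
have [sk|ks] := ltnP s k.
  rewrite (_ : [set _ | _] = v @^-1` [set y | F y < nth 0 t s]).
    by rewrite -[X in measurable X]setTI; exact: mv.
  by apply/seteqP; split => x /=; rewrite c_leE.
rewrite (_ : [set _ | _] = setT)//; apply/seteqP; split => // x _ /=.
by rewrite (leq_trans (c_le x))// size_map size_tuple.
Qed.

Let cell0 : [set x | c x = 0%N] = [set x | (c x <= 0)%N].
Proof. by apply/seteqP; split => x /=; [move=> ->|rewrite leqn0 => /eqP]. Qed.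

Let cellS l : [set x | c x = l.+1] =
  [set x | (c x <= l.+1)%N] `\` [set x | (c x <= l)%N].
Proof.
apply/seteqP; split => x /=; first by move=> ->; rewrite ltnn.
by move=> [c1 /negP]; rewrite -ltnNge => c2; apply/eqP; rewrite eqn_leq c1.
Qed.

Let measurable_cell l : measurable [set x | c x = l].
Proof. by case: l => [|l]; rewrite ?cell0// cellS; exact: measurableD. Qed.

Let P_c_le j s : P [set w | (c (X j w) <= s)%N] = (nth 1 a s)%:E.
Proof.
(* Past the last threshold the event is certain, in agreement with the default 1. *)
have [sk|ks] := ltnP s k; last first.
  rewrite nth_default ?size_map ?size_tuple// -[RHS](probability_setT P).
  congr (P _); apply/seteqP; split => // w _ /=.
  by rewrite (leq_trans (c_le _))// size_map size_tuple.
rewrite (nth_map 0) ?size_tuple// -probability_fine_cdf_lt -(X_law j (mFlt _)).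
by congr (P _); apply/seteqP; split => w /=; rewrite c_leE.
Qed.

Let P_cell j (l : 'I_(size a).+1) :
  P [set w | c (X j w) = l] = (cell_width a l).[0]%:E.
Proof.
have mX s : measurable [set w | (c (X j w) <= s)%N].
  exact: (measurable_funPTI (X j) (measurable_c_le s)).
(* Cell 0 starts at the indeterminate, evaluated at 0; the other cells are differences of nested
   events. *)
case: l => -[|l] /= la; rewrite /cell_width hornerD hornerN hornerC /=.
  rewrite hornerX subr0 -(P_c_le j).
  rewrite -[X in _ = P X]/(X j @^-1` [set x | (c x <= 0)%N]).
  by rewrite -cell0.
rewrite (nth_map 1 0 polyC)// hornerC EFinB -!(P_c_le j).
have -> : [set w | c (X j w) = l.+1] =
    [set w | (c (X j w) <= l.+1)%N] `\` [set w | (c (X j w) <= l)%N].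
  by rewrite -[LHS]/(X j @^-1` [set x | c x = l.+1]) cellS.
rewrite measureD//; last first.
  by rewrite (le_lt_trans (probability_le1 _ _)) ?ltry//.
congr (_ - P _)%E; apply/seteqP; split => w /=; first by case.
by move=> cl; split => //; exact: leqW.
Qed.

Lemma order_stat_law (i : k.-tuple nat) :
  (forall s, 0 < tnth i s <= N)%N ->
  P [set w | forall s : 'I_k,
       F (order_stat (fun j => v (X j w)) (tnth i s)) < tnth t s] =
  (count_poly a N i).[0]%:E.
Proof.
move=> iN; rewrite -(probability_count X_indep c_le measurable_cell P_cell);
  last by rewrite size_map !size_tuple.
congr (P _); apply/seteqP; split => w /= iw s.
  rewrite size_tuple => sk; have := iw (Ordinal sk).
  rewrite (order_stat_count (p := fun y => F y < _))//.
  - rewrite (tnth_nth 0%N) (tnth_nth 0) /=; congr leq.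
    by apply: eq_bigr => j _; rewrite c_leE.
  - by move=> x y /(fine_cdf_nondecreasing V)/le_lt_trans; exact.
rewrite (order_stat_count (p := fun y => F y < _))//.
- have := iw s; rewrite size_tuple => /(_ (ltn_ord s)).
  rewrite (tnth_nth 0%N) (tnth_nth 0) => /leq_trans; apply.
  by apply: leq_sum => j _; rewrite c_leE.
- by move=> x y /(fine_cdf_nondecreasing V)/le_lt_trans; exact.
Qed.

End order_stat_law.

Theorem theorem2 (d : measure_display) (Omega : measurableType d)
    (R : realType) (P : probability Omega R)
    (n : nat) (Q : set (n.-tuple R)) (hQ : compact_tuple Q)
    (q : {RV P >-> n.-tuple R}) (hqQ : forall w, Q (q w))
    (p : n.-tuple R -> R) (hp : is_density q p)
    (u : n.-tuple R -> R) (hu : measurable_fun Q u)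
    (N : nat) (qs : 'I_N -> {RV P >-> n.-tuple R})
    (hqsQ : forall j w, Q (qs j w))
    (hindep : mutually_independent qs)
    (hident : forall j, identically_distributed (qs j) q)
    (k : nat) (hk : (1 <= k <= N)%N)
    (i : k.-tuple nat) (hi : path ltn 0%N (rcons i N.+1))
    (t : k.-tuple R) (ht : path <=%R 0 (rcons t 1)) :
  let Fu := cdf_of P q u in
  let uhat := fun (j : nat) (w : Omega) => order_stat (fun l => u (qs l w)) j in
  let Ftilde :=
    P [set w | forall s : 'I_k, Fu (uhat (tnth i s) w) < tnth t s] in
  let integral_on := fun a : k.-tuple R =>
    (\int[@lebesgue_tuple R k]_(x in ordered_domain a)
       (order_density N i x)%:E)%E in
  [/\ Ftilde = integral_on [tuple tau Fu (tnth t s) | s < k],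
      (Ftilde <= integral_on t)%E &
      continuous Fu -> Ftilde = integral_on t].
Proof.
move=> Fu uhat Ftilde integral_on.
have mQ := measurable_compact_tuple hQ.
(* Extending [u] by 0 outside [Q] gives a function measurable everywhere that agrees with [u] on all
   samples. *)
pose v := u \_ Q.
have mv : measurable_fun setT v by exact: (measurable_restrictT _ mQ).1 hu.
have vE x : Q x -> v x = u x by move=> Qx; rewrite /v patchE mem_set.
have mV : measurable_fun setT (v \o q) by exact: measurableT_comp.
pose V : {RV P >-> R} := HB.pack (v \o q) (isMeasurableFun.Build _ _ _ _ _ mV).
have FuE : Fu = (fun x => fine (P [set w | V w <= x])).
  apply/funext => x; congr (fine (P _)).
  by apply/seteqP; split => w /=; rewrite vE.
have X_law j (A : set R) : measurable A ->
    P [set w | A (v (qs j w))] = P [set w | A (V w)].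
  move=> mA; apply: (hident j (v @^-1` A)).
  by rewrite -[X in measurable X]setTI; exact: mv.
have tS : sorted <=%R t.
  by move: ht; rewrite rcons_path => /andP[/path_sorted].
have t01 s : 0 <= tnth t s <= 1.
  exact: (path_rcons_between le_trans ht (mem_tnth s t)).
have iN s : (0 < tnth i s <= N)%N.
  exact: (path_rcons_between ltn_trans hi (mem_tnth s i)).
pose a := [tuple tau Fu (tnth t s) | s < k].
have aE : tval a = [seq tau Fu r | r <- t].
  suff -> : a = [tuple of [seq tau Fu r | r <- t]] by [].
  by apply: eq_from_tnth => s; rewrite tnth_mktuple tnth_map.
have aP : path <=%R 0 (rcons a 1).
  have tau_homo : {homo tau Fu : x y / x <= y}.
    by move=> x y; rewrite FuE; exact: tau_nondecreasing.
  (* The nondecreasing tau maps the chain [0 <= t_1 <= ... <= t_k <= 1] to one from tau of 0 to tau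
     of 1; its ends are then widened to 0 and 1. *)
  have := homo_path tau_homo ht; rewrite aE map_rcons !rcons_path.
  move=> /andP[/(path_le le_trans) -> /=]; last by rewrite FuE tau_ge0.
  move: (tau_ge0 V 0); rewrite -FuE; case: [seq _ | _ <- _] => [_ _|? ?] /=.
    exact: ler01.
  by move=> _ /le_trans; apply; rewrite FuE tau_le1.
have FtE : Ftilde = integral_on a.
  rewrite /integral_on (integral_order_density hi aP) aE FuE.
  rewrite -(order_stat_law hindep mv X_law tS iN) /Ftilde FuE.
  have uv w : (fun l => u (qs l w)) = (fun l => v (qs l w)).
    by apply/funext => l; rewrite vE.
  by congr (P _); apply/seteqP; split => w iw s; have := iw s; rewrite /uhat uv.
split => //.
(* The domain grows from the tau's to the [t_s], and the density is nonnegative on the larger one,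
   where [x_k <= 1]. *)
- rewrite FtE /integral_on; apply: ge0_subset_integral.
  + exact: measurable_ordered_domain_from.
  + exact: measurable_ordered_domain_from.
  + apply/measurable_EFinP; apply: measurable_funTS.
    rewrite (funext (order_densityE N i)).
    by apply: measurable_funM => //; exact: measurable_gap_prod.
  + move=> x xD; rewrite lee_fin order_densityE mulr_ge0//.
    rewrite gap_prod_ge0 ?size_tuple//.
    exact: ordered_domain_from_path xD.
  + move=> x [xP xa]; split => // s; apply: le_trans (xa s) _.
    by rewrite tnth_mktuple FuE tau_le//; case/andP: (t01 s).
- move=> cF; rewrite FtE; congr integral_on.
  apply: eq_from_tnth => s; rewrite tnth_mktuple.
  by rewrite FuE tau_continuous// -FuE.
Qed.
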